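(* Let $\mathcal H$ be a Hopf algebra and $\Lambda\in\mathcal H$ an element of integral type. Then: (1) if $\mathcal A_\Lambda$ is unimodular and admits a faithful $1$-cointegral, then $S(\Lambda)=\Lambda$ and $S^2(\mathcal A_\Lambda)=\mathcal A_\Lambda$; (2) if $\Lambda^2=\Lambda$ and $\mathcal A_\Lambda$ admits a faithful $1$-cointegral, then $\mathcal A_\Lambda$ is unimodular, $S^2(\mathcal A_\Lambda)=\mathcal A_\Lambda$, $\Lambda$ is a two-sided group-like projection, and $\mathcal A_\Lambda$ is semisimple; (3) if $\mathcal A$ is a semisimple left coideal subalgebra of $\mathcal H$ with $S^2(\mathcal A)=\mathcal A$, then $\mathcal A$ admits a faithful $1$-cointegral, unique up to a multiplicative constant.
   Context: $k$ is a field; $\mathcal H$ is a Hopf algebra over $k$ with comultiplication $\Delta$, counit $\varepsilon$, invertible antipode $S$. A left coideal subalgebra is a subalgebra $\mathcal A\ni1$ with $\Delta(\mathcal A)\subset\mathcal H\otimes\mathcal A$. A non-zero $\Lambda$ is of integral type if $\Delta(\Lambda)(1\otimes\Lambda)=\Lambda\otimes\Lambda$; $\mathcal A_\Lambda=\{a\in\mathcal H:\Delta(a)(1\otimes\Lambda)=b\otimes\Lambda\text{ for some }b\in\mathcal H\}$. $L^{\mathcal A}_\varepsilon=\{x\in\mathcal A: ax=\varepsilon(a)x\ \forall a\}$, $R^{\mathcal A}_\varepsilon=\{x\in\mathcal A: xa=\varepsilon(a)x\ \forall a\}$, and $\mathcal A$ is unimodular if they coincide. A $1$-cointegral on $\mathcal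 A$ is $\phi\in\mathcal A'$ with $(\mathrm{id}\otimes\phi)(\Delta(a))=\phi(a)1$ for all $a\in\mathcal A$; it is faithful if $\phi(ab)=0$ for all $b$ implies $a=0$. A non-zero idempotent $P$ is a two-sided group-like projection if $\Delta(P)(1\otimes P)=(1\otimes P)\Delta(P)=P\otimes P$ and $\Delta(P)(P\otimes1)=(P\otimes1)\Delta(P)=P\otimes P$. *)

(* Defs.v *)
(* Hopf algebras over a field k, possibly infinite dimensional.
   Tensors in H (x) H are represented by finite lists of pairs (sum of simple
   tensors); equality of tensors is the genuine equality in H (x) H, expressed
   through the (over a field, faithful) slice maps (f (x) id). *)
From HB Require Import structures.
From mathcomp Require Import all_boot all_order all_algebra.
Set Implicit Arguments. Unset Strict Implicit. Unset Printing Implicit Defensive.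
Import Order.TTheory GRing.Theory Num.Theory.
Local Open Scope ring_scope.

Section Hopf.
Variables (k : fieldType) (H : algType k).

Definition klinear (f : H -> k) :=
  forall (a : k) (x y : H), f (a *: x + y) = a * f x + f y.

(* sum_i x_i (x) y_i = 0 in H (x) H *)
Definition tzero2 (s : seq (H * H)) :=
  forall f, klinear f -> \sum_(p <- s) f p.1 *: p.2 = 0.
Definition teq2 (s t : seq (H * H)) :=
  tzero2 (s ++ [seq (- p.1, p.2) | p <- t]).
Definition tmul2 (s t : seq (H * H)) : seq (H * H) :=
  [seq (p.1 * q.1, p.2 * q.2) | p <- s, q <- t].

(* sum_i x_i (x) y_i (x) z_i = 0 in H (x) H (x) H *)
Definition tzero3 (s : seq (H * H * H)) :=
  forall f g, klinear f -> klinear g ->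
    \sum_(p <- s) (f p.1.1 * g p.1.2) *: p.2 = 0.
Definition teq3 (s t : seq (H * H * H)) :=
  tzero3 (s ++ [seq (- p.1.1, p.1.2, p.2) | p <- t]).

Variables (Delta : H -> seq (H * H)) (eps : H -> k) (S : H -> H).

Record is_hopf : Prop := IsHopf {
  Delta_lin : forall (a : k) x y,
      teq2 (Delta (a *: x + y))
           ([seq (a *: p.1, p.2) | p <- Delta x] ++ Delta y);
  Delta_mul : forall x y, teq2 (Delta (x * y)) (tmul2 (Delta x) (Delta y));
  Delta_one : teq2 (Delta 1) [:: (1, 1)];
  Delta_coass : forall x,
      teq3 [seq (q.1, q.2, p.2) | p <- Delta x, q <- Delta p.1]
           [seq (p.1, q.1, q.2) | p <- Delta x, q <- Delta p.2];
  eps_lin : klinear eps;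
  eps_mul : forall x y, eps (x * y) = eps x * eps y;
  eps_one : eps 1 = 1;
  counit_l : forall x, \sum_(p <- Delta x) eps p.1 *: p.2 = x;
  counit_r : forall x, \sum_(p <- Delta x) eps p.2 *: p.1 = x;
  S_lin : forall (a : k) x y, S (a *: x + y) = a *: S x + S y;
  antipode_l : forall x, \sum_(p <- Delta x) S p.1 * p.2 = eps x *: 1;
  antipode_r : forall x, \sum_(p <- Delta x) p.1 * S p.2 = eps x *: 1;
  S_bij : bijective S
}.

Definition left_coideal_subalg (A : H -> Prop) :=
  [/\ A 1, (forall x y, A x -> A y -> A (x + y)),
      (forall x y, A x -> A y -> A (x * y)),
      (forall (a : k) x, A x -> A (a *: x)) &
      (forall x, A x -> exists s, teq2 (Delta x) s /\
                                  forall p, p \in s -> A p.2)].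

Definition integral_type (L : H) :=
  L != 0 /\ teq2 (tmul2 (Delta L) [:: (1, L)]) [:: (L, L)].

Definition A_of (L : H) (a : H) : Prop :=
  exists b, teq2 (tmul2 (Delta a) [:: (1, L)]) [:: (b, L)].

Definition L_eps (A : H -> Prop) (x : H) :=
  A x /\ forall a, A a -> a * x = eps a *: x.
Definition R_eps (A : H -> Prop) (x : H) :=
  A x /\ forall a, A a -> x * a = eps a *: x.
Definition unimodular (A : H -> Prop) := forall x, L_eps A x <-> R_eps A x.

(* phi : H -> k, only its restriction to A matters (element of A') *)
Definition cointegral1 (A : H -> Prop) (phi : H -> k) :=
  (forall (c : k) x y, A x -> A y -> phi (c *: x + y) = c * phi x + phi y) /\
  (forall a s, A a -> teq2 (Delta a) s -> (forall p, p \in s -> A p.2) ->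
     \sum_(p <- s) phi p.2 *: p.1 = phi a *: 1).

Definition faithful (A : H -> Prop) (phi : H -> k) :=
  forall a, A a -> (forall b, A b -> phi (a * b) = 0) -> a = 0.

Definition S2_stable (A : H -> Prop) :=
  forall x, A x <-> exists y, A y /\ x = S (S y).

Definition two_sided_glp (P : H) :=
  [/\ P != 0, P * P = P,
      teq2 (tmul2 (Delta P) [:: (1, P)]) [:: (P, P)] /\
      teq2 (tmul2 [:: (1, P)] (Delta P)) [:: (P, P)],
      teq2 (tmul2 (Delta P) [:: (P, 1)]) [:: (P, P)] &
      teq2 (tmul2 [:: (P, 1)] (Delta P)) [:: (P, P)]].

Definition left_ideal (A I : H -> Prop) :=
  [/\ (forall x, I x -> A x), I 0, (forall x y, I x -> I y -> I (x + y)),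
      (forall x, I x -> I (- x)) & (forall a x, A a -> I x -> I (a * x))].

Definition semisimple (A : H -> Prop) :=
  forall I, left_ideal A I ->
    exists J, [/\ left_ideal A J, (forall x, I x -> J x -> x = 0) &
                  (forall a, A a -> exists x y, [/\ I x, J y & a = x + y])].

End Hopf.

(* Main.v *)
(* For a left integral L of A, a_(1) (x) a_(2) L = a (x) L yields the Casimir
   property L_(1) (x) a L_(2) = S a L_(1) (x) L_(2) for a in A.

   A 1-cointegral phi therefore satisfies phi (a L_(2)) L_(1) = phi L * S a.  When
   phi is faithful, phi L <> 0: otherwise some left integral x = L b has
   phi x <> 0, the formula for x shows that A is finite dimensional, so the form
   phi (a b) is nondegenerate on both sides, contradicting phi (a L) = eps a phi L = 0.
   If L is also a right integral, the formula at a = L gives S L = L, and S^2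
   preserves A_L.  If L is idempotent, nondegeneracy makes the left integrals
   one dimensional, so L is a right integral; semisimplicity is Maschke averaging
   with the Casimir element L_(2) (x) S^-1 L_(1).

   Conversely, a complement of ker eps in a semisimple A is spanned by an
   integral L with eps L = 1, two-sided since nilpotent left ideals vanish, and
   fixed by S^2 by uniqueness.  Applying S to S L * L = L gives S L = L.  The
   slices f (L_(1)) L_(2) form a two-sided ideal whose complement annihilates it
   and is therefore 0.  So 1 = f (L_(1)) L_(2) for some f, and phi = f o S^-1 is
   the cointegral.

   Identities between tensors are transported to arbitrary multilinear maps by
   linear functionals and projections on H, which Zorn's lemma provides. *)
Require Import Defs.
From HB Require Import structures.
From mathcomp Require Import all_boot all_order all_algebra zify.
From mathcomp Require Import boolp classical_sets.
Import GRing.Theory.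
Local Open Scope ring_scope.
Set Implicit Arguments.
Unset Strict Implicit.
Unset Printing Implicit Defensive.

(** * Linear algebra over a field: complements, projections, functionals *)

Section LinearMaps.
Variable k : fieldType.

Definition lin (V W : lmodType k) (f : V -> W) : Prop :=
  forall c x y, f (c *: x + y) = c *: f x + f y.

Definition klin (V : lmodType k) (f : V -> k) : Prop :=
  forall c x y, f (c *: x + y) = c * f x + f y.

Definition bilin (U V W : lmodType k) (F : U -> V -> W) : Prop :=
  (forall v, lin (F^~ v)) /\ (forall u, lin (F u)).

Definition trilin (U V W X : lmodType k) (T : U -> V -> W -> X) : Prop :=
  [/\ forall v w, lin (fun u => T u v w), forall u w, lin (fun v => T u v w) &
      forall u v, lin (T u v)].

Definition subspace (V : lmodType k) (U : V -> Prop) : Prop :=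
  U 0 /\ forall c x y, U x -> U y -> U (c *: x + y).

Section Basics.
Variables (V W : lmodType k) (f : V -> W).
Hypothesis lf : lin f.

Lemma lin0 : f 0 = 0.
Proof. by have := lf (-1) 0 0; rewrite scaler0 addr0 scaleN1r addNr. Qed.

Lemma linZ c x : f (c *: x) = c *: f x.
Proof. by have := lf c x 0; rewrite !addr0 lin0 addr0. Qed.

Lemma linD x y : f (x + y) = f x + f y.
Proof. by have := lf 1 x y; rewrite !scale1r. Qed.

Lemma linN x : f (- x) = - f x.
Proof. by rewrite -scaleN1r linZ scaleN1r. Qed.

Lemma linB x y : f (x - y) = f x - f y.
Proof. by rewrite linD linN. Qed.

Lemma lin_sum I (r : seq I) (P : pred I) (F : I -> V) :
  f (\sum_(i <- r | P i) F i) = \sum_(i <- r | P i) f (F i).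
Proof. exact: (big_morph f linD lin0). Qed.
End Basics.

Section Functionals.
Variables (V : lmodType k) (f : V -> k).
Hypothesis lf : klin f.

Lemma klin_lin : lin (f : V -> k^o). Proof. exact: lf. Qed.

Lemma klin0 : f 0 = 0. Proof. exact: (lin0 klin_lin). Qed.

Lemma klinZ c x : f (c *: x) = c * f x. Proof. exact: (linZ klin_lin). Qed.

Lemma klinD x y : f (x + y) = f x + f y. Proof. exact: (linD klin_lin). Qed.

Lemma klinB x y : f (x - y) = f x - f y. Proof. exact: (linB klin_lin). Qed.

Lemma klin_sum I (r : seq I) (P : pred I) (F : I -> V) :
  f (\sum_(i <- r | P i) F i) = \sum_(i <- r | P i) f (F i).
Proof. exact: (big_morph f klinD klin0). Qed.
End Functionals.

Section Subspaces.
Variables (V : lmodType k) (U : V -> Prop).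
Hypothesis sU : subspace U.

Lemma subspaceZ c x : U x -> U (c *: x).
Proof. by move=> Ux; rewrite -[_ *: _]addr0; apply: sU.2 => //; case: sU. Qed.

Lemma subspaceD x y : U x -> U y -> U (x + y).
Proof. by move=> Ux Uy; rewrite -[x]scale1r; apply: sU.2. Qed.

Lemma subspaceB x y : U x -> U y -> U (x - y).
Proof. by move=> Ux Uy; rewrite addrC -scaleN1r; apply: sU.2. Qed.

Lemma subspace_sum I (r : seq I) (F : I -> V) :
  (forall i, U (F i)) -> U (\sum_(i <- r) F i).
Proof.
by move=> UF; apply: (big_ind U) => //; [case: sU | exact: subspaceD].
Qed.

Lemma subspace_complement : exists C : V -> Prop,
  [/\ subspace C, forall x, C x -> U x -> x = 0 &
      forall x, exists2 u, U u & C (x - u)].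
Proof.
have [U0 Ucl] := sU.
(* [P] does not ask for 0, so the union of the empty chain satisfies it; [C0] adds 0 afterwards. *)
pose P (C : set V) := (forall c x y, C x -> C y -> C (c *: x + y)) /\
                      (forall x, C x -> U x -> x = 0).
have [|C [[Ccl CU] Cmax]] := @Zorn_bigcup V P.
  move=> F FP Ftot; split=> [c x y [X FX Xx] [Y FY Yy]|x [X FX Xx]].
    by case: (Ftot X Y FX FY) => [XY|YX];
      [exists Y | exists X] => //; apply: (FP _ _).1 => //; auto.
  exact: (FP X FX).2.
pose C0 x := C x \/ x = 0.
have C0cl : subspace C0.
  split=> [|c x y [Cx|->] [Cy|->]]; first by right.
  - by left; apply: Ccl.
  - left; rewrite addr0; have -> : c *: x = (c - 1) *: x + x.
      by rewrite scalerBl scale1r subrK.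
    exact: Ccl.
  - by left; rewrite scaler0 add0r.
  - by right; rewrite scaler0 addr0.
have C0U x : C0 x -> U x -> x = 0 by case=> // Cx; apply: CU.
exists C0; split=> // h; apply: contrapT => nh.
(* A vector [h] outside U + C0 would allow [C] to grow to the span of [h] and [C0]. *)
pose B : set V := fun x => exists c z, C0 z /\ x = c *: h + z.
have notin z u : C0 z -> U u -> h <> u + z.
  by move=> Cz Uu eh; apply: nh; exists u => //; rewrite eh addrC addKr.
apply: (Cmax B).
  split=> [x Cx|BC]; first by exists 0, x; rewrite scale0r add0r; split=> //; left.
  have /BC Ch : B h by exists 1, 0; rewrite scale1r addr0; split=> //; right.
  by apply: (notin h 0) => //; [left | rewrite add0r].
split=> [d _ _ [c [z [Cz ->]]] [c' [z' [Cz' ->]]]|_ [c [z [Cz ->]]]].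
  exists (d * c + c'), (d *: z + z'); split; first exact: C0cl.2.
  by rewrite scalerDr scalerDl scalerA addrACA.
have [->|c0] := eqVneq c 0; first by rewrite scale0r add0r; apply: C0U.
move=> Ux; have Uz : U (c^-1 *: (c *: h + z)).
  by rewrite -[_ *: _]addr0; apply: Ucl.
have Cz' : C0 (- c^-1 *: z).
  by rewrite -[_ *: _]addr0; apply: C0cl.2 => //; right.
case: (notin _ _ Cz' Uz).
by rewrite scalerDr scalerA mulVf // scale1r scaleNr addrK.
Qed.

Lemma linear_projection :
  exists p : V -> V, [/\ lin p, forall x, U (p x) & forall x, U x -> p x = x].
Proof.
have [C [sC CU UC]] := subspace_complement.
pose p x := projT1 (cid2 (UC x)).
have Up x : U (p x) by rewrite /p; case: (cid2 _).
have Cp x : C (x - p x) by rewrite /p; case: (cid2 _).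
have uniq x u : U u -> C (x - u) -> p x = u.
  move=> Uu Cu; apply/eqP; rewrite -subr_eq0; apply/eqP.
  apply: CU; last by apply: subspaceB.
  have -> : p x - u = (-1) *: (x - p x) + (x - u).
    by rewrite scaleN1r opprB addrA subrK.
  exact: sC.2.
exists p; split=> // [c x y|x Ux].
  apply: uniq; first exact: sU.2.
  have -> : c *: x + y - (c *: p x + p y) = c *: (x - p x) + (y - p y).
    by rewrite scalerBr opprD addrACA.
  exact: sC.2.
by apply: uniq => //; rewrite subrr; case: sC.
Qed.
End Subspaces.

Lemma scaler_injr (V : lmodType k) (x : V) a b : x != 0 -> a *: x = b *: x -> a = b.
Proof.
move=> x0 /eqP; rewrite -subr_eq0 -scalerBl scaler_eq0 (negPf x0) orbF subr_eq0.
by move/eqP.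
Qed.

Lemma separating_functional (V : lmodType k) (x : V) : x != 0 ->
  exists2 f : V -> k, klin f & f x = 1.
Proof.
move=> x0; pose U y := exists c, y = c *: x.
have sU : subspace U.
  split=> [|c _ _ [a ->] [b ->]]; first by exists 0; rewrite scale0r.
  by exists (c * a + b); rewrite scalerDl scalerA.
have [p [lp Up pU]] := linear_projection sU.
pose f y : k := projT1 (cid (Up y)).
have fE y : p y = f y *: x by rewrite /f; case: (cid _).
exists f => [c y z|]; apply: (scaler_injr x0).
  by rewrite -fE lp !fE scalerDl -scalerA.
by rewrite -fE scale1r pU //; exists 1; rewrite scale1r.
Qed.

(* With [T i = B (-, y i)] for a bilinear [B], this says that the slices
   [f (x) id] detect [sum_i x i (x) y i = 0]. *)
Lemma contraction_eq0 (I : Type) (V W : lmodType k) (s : seq I) (x : I -> V)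
    (T : I -> V -> W) : (forall i, lin (T i)) ->
  (forall f : V -> k, klin f -> forall h, \sum_(i <- s) f (x i) *: T i h = 0) ->
  \sum_(i <- s) T i (x i) = 0.
Proof.
move=> lT; elim: s x => [|i s IHs] x hs; first by rewrite big_nil.
rewrite big_cons; have [xi0|xi0] := eqVneq (x i) 0.
  rewrite xi0 lin0 // add0r; apply: IHs => f lf h.
  by have := hs f lf h; rewrite big_cons xi0 klin0 // scale0r add0r.
(* Elimination: [f] expresses [T i] through the later maps, so the head term is absorbed by
   replacing [x j] with [x j - f (x j) *: x i]. *)
have [f lf fxi] := separating_functional xi0.
have fE h : \sum_(j <- s) f (x j) *: T j h = - T i h.
  apply/eqP; rewrite -subr_eq0 opprK addrC; apply/eqP.
  by have := hs f lf h; rewrite big_cons fxi scale1r.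
rewrite -[T i (x i)]opprK -fE addrC -sumrB.
rewrite -[RHS](IHs (fun j => x j - f (x j) *: x i)).
  by apply: eq_bigr => j _; rewrite (linB (lT j)) (linZ (lT j)).
move=> g lg h; under eq_bigr => j _ do
  rewrite (klinB lg) (klinZ lg) scalerBl [_ * g (x i)]mulrC -scalerA.
rewrite sumrB -scaler_sumr fE scalerN opprK addrC.
by have := hs g lg h; rewrite big_cons.
Qed.
End LinearMaps.

Section Combinators.
Variables (k : fieldType) (H : algType k) (U V W : lmodType k).

Lemma lin_id : lin (fun x : V => x). Proof. by []. Qed.

Lemma lin_comp (f : V -> W) (g : U -> V) :
  lin f -> lin g -> lin (fun x => f (g x)).
Proof. by move=> lf lg c x y; rewrite lg lf. Qed.

Lemma klin_comp (f : V -> k) (g : U -> V) :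
  klin f -> lin g -> klin (fun x => f (g x)).
Proof. by move=> lf lg c x y; rewrite lg lf. Qed.

Lemma lin_mulr (f : V -> H) z : lin f -> lin (fun x => f x * z).
Proof. by move=> lf c x y; rewrite lf mulrDl scalerAl. Qed.

Lemma lin_mull (f : V -> H) z : lin f -> lin (fun x => z * f x).
Proof. by move=> lf c x y; rewrite lf mulrDr scalerAr. Qed.

Lemma lin_scalel (f : V -> k) (w : W) : klin f -> lin (fun x => f x *: w).
Proof. by move=> lf c x y; rewrite lf scalerDl scalerA. Qed.

Lemma lin_scaler (f : V -> W) a : lin f -> lin (fun x => a *: f x).
Proof. by move=> lf c x y; rewrite lf scalerDr !scalerA mulrC. Qed.

Lemma lin_bigsum I (s : seq I) (F : V -> I -> W) :
  (forall i, lin (F^~ i)) -> lin (fun x => \sum_(i <- s) F x i).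
Proof.
by move=> lF c x y; rewrite scaler_sumr -big_split; apply: eq_bigr => i _; apply: lF.
Qed.
End Combinators.

(** * Evaluating tensor identities under multilinear maps *)

Section Tensors.
Variables (k : fieldType) (H : algType k) (W : lmodType k).

Lemma tzero2_bilin (s : seq (H * H)) (F : H -> H -> W) :
  bilin F -> tzero2 s -> \sum_(p <- s) F p.1 p.2 = 0.
Proof.
move=> [F1 F2] s0; apply: (contraction_eq0 (T := fun p h => F h p.2)) => // f lf h.
under eq_bigr => p _ do rewrite -(linZ (F2 h)).
by rewrite -(lin_sum (F2 h)) (s0 f lf) (lin0 (F2 h)).
Qed.

Lemma tzero3_trilin (s : seq (H * H * H)) (F : H -> H -> H -> W) :
  trilin F -> tzero3 s -> \sum_(p <- s) F p.1.1 p.1.2 p.2 = 0.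
Proof.
move=> [F1 F2 F3] s0.
apply: (contraction_eq0 (T := fun p h => F h p.1.2 p.2)) => // f lf h.
apply: (contraction_eq0 (x := fun p => p.1.2)
          (T := fun p h' => f p.1.1 *: F h h' p.2)) => [p|g lg h'].
  exact: lin_scaler.
under eq_bigr => p _ do rewrite scalerA mulrC -(linZ (F3 h h')).
by rewrite -(lin_sum (F3 h h')) (s0 f g lf lg) (lin0 (F3 h h')).
Qed.

Lemma teq2_bilin (s t : seq (H * H)) (F : H -> H -> W) : bilin F -> teq2 s t ->
  \sum_(p <- s) F p.1 p.2 = \sum_(p <- t) F p.1 p.2.
Proof.
move=> bF /(tzero2_bilin bF); rewrite big_cat big_map /=.
under [X in _ + X]eq_bigr => p _ do rewrite (linN (bF.1 _)).
by rewrite sumrN => /eqP; rewrite subr_eq0 => /eqP.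
Qed.

Lemma teq3_trilin (s t : seq (H * H * H)) (F : H -> H -> H -> W) :
  trilin F -> teq3 s t ->
  \sum_(p <- s) F p.1.1 p.1.2 p.2 = \sum_(p <- t) F p.1.1 p.1.2 p.2.
Proof.
move=> tF; have [F1 _ _] := tF; move=> /(tzero3_trilin tF).
rewrite big_cat big_map /=.
under [X in _ + X]eq_bigr => p _ do rewrite (linN (F1 _ _)).
by rewrite sumrN => /eqP; rewrite subr_eq0 => /eqP.
Qed.
End Tensors.

Lemma teq2I (k : fieldType) (H : algType k) (s t : seq (H * H)) :
  (forall f : H -> k, klin f ->
     \sum_(p <- s) f p.1 *: p.2 = \sum_(p <- t) f p.1 *: p.2) -> teq2 s t.
Proof.
move=> st f lf; rewrite big_cat big_map /=.
under [X in _ + X]eq_bigr => p _ do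
  rewrite -scaleN1r (klinZ lf) mulN1r scaleNr.
by rewrite sumrN st // subrr.
Qed.

(** * Sweedler sums *)

Section Sweedler.
Variables (k : fieldType) (H : algType k) (Delta : H -> seq (H * H)).

(* [sweedler a F] is [F a_(1) a_(2)] in Sweedler notation. *)
Definition sweedler (W : lmodType k) (a : H) (F : H -> H -> W) : W :=
  \sum_(p <- Delta a) F p.1 p.2.

Lemma eq_sweedler (W : lmodType k) a (F G : H -> H -> W) :
  (forall u v, F u v = G u v) -> sweedler a F = sweedler a G.
Proof. by move=> FG; apply: eq_bigr => p _. Qed.

Lemma lin_sweedler (V W : lmodType k) a (F : V -> H -> H -> W) :
  (forall u v, lin (fun x => F x u v)) -> lin (fun x => sweedler a (F x)).
Proof. by move=> lF; apply: lin_bigsum. Qed.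

Lemma sweedler_lin (V W : lmodType k) a (F : H -> H -> V) (f : V -> W) :
  lin f -> f (sweedler a F) = sweedler a (fun u v => f (F u v)).
Proof. by move=> lf; apply: lin_sum. Qed.

Lemma sweedlerZ (W : lmodType k) a (F : H -> H -> W) c :
  c *: sweedler a F = sweedler a (fun u v => c *: F u v).
Proof. exact: scaler_sumr. Qed.

Lemma sweedler_klin (V W : lmodType k) a (F : H -> H -> V) (f : V -> k) (w : W) :
  klin f -> f (sweedler a F) *: w = sweedler a (fun u v => f (F u v) *: w).
Proof. by move=> lf; rewrite /sweedler (klin_sum lf) scaler_suml. Qed.

Lemma exchange_sweedler (W : lmodType k) a b (F : H -> H -> H -> H -> W) :
  sweedler a (fun u v => sweedler b (F u v)) =
  sweedler b (fun x y => sweedler a (fun u v => F u v x y)).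
Proof. exact: exchange_big. Qed.
End Sweedler.
Arguments sweedler_lin {k H Delta V W a F f}.
Arguments sweedler_klin {k H Delta V W a F f w}.

(** * The antipode reverses products and coproducts *)

Section Antipode.
Variables (k : fieldType) (H : algType k) (Delta : H -> seq (H * H)).
Variables (eps : H -> k) (S : H -> H).
Hypothesis hH : is_hopf Delta eps S.
Local Notation sw := (sweedler Delta).

Lemma klin_eps : klin eps. Proof. exact: eps_lin hH. Qed.
Lemma lin_S : lin S. Proof. exact: S_lin hH. Qed.

(** The list [Delta a] is linear in [a] only up to [teq2], a difference that a bilinear [F] cannot
    see. *)
Lemma lin_sweedler_arg (V W : lmodType k) (f : V -> H) (F : H -> H -> W) :
  bilin F -> lin f -> lin (fun x => sw (f x) F).
Proof.
move=> bF lf c x y; rewrite lf /sweedler (teq2_bilin bF (Delta_lin hH c _ _)).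
rewrite big_cat big_map scaler_sumr; congr (_ + _).
by apply: eq_bigr => p _ /=; rewrite (linZ (bF.1 _)).
Qed.

(** Syntax-directed search for linearity proofs. In a Sweedler sum the variable may occur in the
    summand or in the comultiplied element; each case has its own rule. *)
Ltac lin_tac := repeat lin_step
with lin_step := first [ assumption | match goal with
 | |- bilin _ => split=> ?; cbv beta
 | |- trilin _ => split=> ? ?; cbv beta
 | |- lin (fun x => x) => exact: lin_id
 | |- lin (fun x => @sweedler _ _ _ _ ?a (@?G x)) =>
     apply: lin_sweedler => ? ?; cbv beta
 | |- lin (fun x => @sweedler _ _ _ _ (@?e x) ?F) =>
     apply: (@lin_sweedler_arg _ _ e F)
 | |- lin (fun x => ?c * @?e x) => apply: lin_mull
 | |- lin (fun x => @?e x * ?c) => apply: lin_mulr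
 | |- lin (fun x => ?c *: @?e x) => apply: lin_scaler
 | |- lin (fun x => @?c x *: ?y) => apply: lin_scalel
 | |- klin eps => exact: klin_eps
 | |- lin S => exact: lin_S
 | b : bilin ?F |- lin (?F _) => exact: b.2
 | b : bilin ?F |- lin (fun x => ?F ?u (@?e x)) => apply: (lin_comp (b.2 u))
 | b : bilin ?F |- lin (fun x => ?F (@?e x) ?v) => apply: (lin_comp (b.1 v))
 | |- lin (_ ?c) => exact: (lin_mull c (@lin_id _ _))
 | |- lin (_ ?c) => exact: (lin_scaler c (@lin_id _ _))
 | b : lin ?f |- lin (fun x => ?f (@?e x)) => apply: (lin_comp b)
 | b : klin ?f |- klin (fun x => ?f (@?e x)) => apply: (klin_comp b)
 | |- lin (fun x => S (@?e x)) => apply: (lin_comp lin_S)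
 | |- klin (fun x => eps (@?e x)) => apply: (klin_comp klin_eps)
 end].

Ltac by_lin := lin_tac; match goal with |- ?g => fail 1 "lin" g end.

Section Basic.
Variable W : lmodType k.
Implicit Types (F : H -> H -> W) (f : H -> W).

Lemma sweedler1 F : bilin F -> sw 1 F = F 1 1.
Proof. by move=> bF; rewrite /sweedler (teq2_bilin bF (Delta_one hH)) big_seq1. Qed.

Lemma sweedlerM F a b : bilin F ->
  sw (a * b) F = sw a (fun u v => sw b (fun x y => F (u * x) (v * y))).
Proof.
move=> bF; rewrite /sweedler (teq2_bilin bF (Delta_mul hH a b)).
by rewrite /tmul2 big_allpairs_dep.
Qed.

Lemma sweedler_coassoc (T : H -> H -> H -> W) a : trilin T ->
  sw a (fun w z => sw w (fun x y => T x y z)) =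
  sw a (fun x w => sw w (fun y z => T x y z)).
Proof.
move=> tT; have := teq3_trilin tT (Delta_coass hH a).
by rewrite !big_allpairs_dep.
Qed.

Lemma sweedler_counitl f a : lin f -> sw a (fun u v => eps u *: f v) = f a.
Proof.
move=> lf; rewrite -[a in RHS](counit_l hH) (lin_sum lf).
by apply: eq_bigr => p _; rewrite (linZ lf).
Qed.

Lemma sweedler_counitr f a : lin f -> sw a (fun u v => eps v *: f u) = f a.
Proof.
move=> lf; rewrite -[a in RHS](counit_r hH) (lin_sum lf).
by apply: eq_bigr => p _; rewrite (linZ lf).
Qed.

Lemma sweedler_antipodel f a : lin f -> sw a (fun u v => f (S u * v)) = eps a *: f 1.
Proof.
by move=> lf; rewrite -(linZ lf) -(antipode_l hH) (lin_sum lf).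
Qed.

Lemma sweedler_antipoder f a : lin f -> sw a (fun u v => f (u * S v)) = eps a *: f 1.
Proof.
by move=> lf; rewrite -(linZ lf) -(antipode_r hH) (lin_sum lf).
Qed.
End Basic.

Lemma eps_S a : eps (S a) = eps a.
Proof.
apply: (scaler_injr (oner_neq0 H)).
have l1 : lin (fun x => eps x *: (1 : H)) by by_lin.
have := sweedler_antipodel a l1.
under eq_sweedler => u v do rewrite (eps_mul hH) mulrC -scalerA.
rewrite (sweedler_counitr (f := fun x => eps (S x) *: (1 : H))); last by_lin.
by rewrite (eps_one hH) scale1r.
Qed.

Lemma S_one : S 1 = 1.
Proof.
have := sweedler_antipodel 1 (@lin_id _ H); rewrite sweedler1; last by_lin.
by rewrite mulr1 (eps_one hH) scale1r.
Qed.

(* Insert [y_(2) S (y_(3))] between [S (x_(1) y)] and [x_(2)]. *)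
Lemma S_mul_aux x y : sw x (fun u v => S (u * y) * v) = eps x *: S y.
Proof.
transitivity (sw y (fun z y3 => sw (x * z) (fun u v => S u * v * S y3))).
  under [RHS]eq_sweedler => z y3.
    rewrite sweedlerM; last by_lin.
    rewrite exchange_sweedler.
    over.
  rewrite (sweedler_coassoc
    (T := fun y1 y2 y3 => sw x (fun u v => S (u * y1) * (v * y2) * S y3)));
    last by_lin.
  under [RHS]eq_sweedler => y1 w do rewrite exchange_sweedler.
  rewrite [RHS]exchange_sweedler; apply: eq_sweedler => u v.
  rewrite -(sweedler_counitr (f := fun y1 => S (u * y1) * v)); last by_lin.
  apply: eq_sweedler => y1 w.
  rewrite -[v in LHS]mulr1.
  rewrite -(sweedler_antipoder (f := fun t => S (u * y1) * (v * t))); last by_lin.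
  by apply: eq_sweedler => y2 y3; rewrite !mulrA.
under eq_sweedler => z y3.
  rewrite (sweedler_antipodel (f := fun t => t * S y3)); last by_lin.
  rewrite mul1r (eps_mul hH) -scalerA.
  over.
by rewrite -sweedlerZ sweedler_counitl; last by_lin.
Qed.

(** Compute S(x_(1) y) x_(2) S(x_(3)) in two ways: the last two factors cancel and leave S(x y),
    while [S_mul_aux] collapses the first two and leaves S(y) S(x). *)
Lemma S_mul x y : S (x * y) = S y * S x.
Proof.
transitivity (sw x (fun w v => sw w (fun u z => S (u * y) * z) * S v)).
  under eq_sweedler => w v.
    rewrite (sweedler_lin (f := fun t => t * S v)); last by_lin.
    over.
  rewrite (sweedler_coassoc (T := fun u z v => S (u * y) * z * S v)); last by_lin.
  under eq_sweedler => u w.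
    under eq_sweedler => z v do rewrite -mulrA.
    rewrite (sweedler_antipoder (f := fun t => S (u * y) * t)); last by_lin.
    over.
  by rewrite (sweedler_counitr (f := fun u => S (u * y) * 1)) ?mulr1 //; by_lin.
under eq_sweedler => w v do rewrite S_mul_aux -scalerAl.
by rewrite (sweedler_counitl (f := fun v => S y * S v)) //; by_lin.
Qed.

Section DeltaS.
Variables (W : lmodType k) (F : H -> H -> W).
Hypothesis bF : bilin F.

(* Insert [x_(3) S (x_(4))] on the right of the second leg. *)
Lemma Delta_S_aux x :
  sw x (fun u w => sw (S u) (fun p q => F (p * w) q)) = F 1 (S x).
Proof.
transitivity (sw x (fun z x4 => sw z (fun x1 w => sw (S x1 * w)
                 (fun p q => F p (q * S x4))))).
  symmetry.
  under eq_sweedler => z x4.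
    under eq_sweedler => x1 w do (rewrite sweedlerM; last by_lin).
    under eq_sweedler => x1 w do rewrite exchange_sweedler.
    over.
  rewrite (sweedler_coassoc (T := fun x1 w x4 => sw w (fun x2 x3 =>
     sw (S x1) (fun p q => F (p * x2) (q * x3 * S x4))))); last by_lin.
  apply: eq_sweedler => x1 w.
  rewrite (sweedler_coassoc (T := fun x2 x3 x4 =>
     sw (S x1) (fun p q => F (p * x2) (q * x3 * S x4)))); last by_lin.
  rewrite -(sweedler_counitr (f := fun w => sw (S x1) (fun p q => F (p * w) q)));
    last by_lin.
  apply: eq_sweedler => x2 w'.
  rewrite exchange_sweedler sweedlerZ; apply: eq_sweedler => p q.
  under eq_sweedler => x3 x4 do rewrite -mulrA.
  by rewrite (sweedler_antipoder (f := fun t => F (p * x2) (q * t))) ?mulr1; last by_lin.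
under eq_sweedler => z x4.
  rewrite (sweedler_antipodel (f := fun t => sw t (fun p q => F p (q * S x4))));
    last by_lin.
  rewrite sweedler1; last by_lin.
  rewrite mul1r.
  over.
by rewrite sweedler_counitl; last by_lin.
Qed.
End DeltaS.

(** The same double evaluation, for S(x_(1))_(1) x_(2) S(x_(3)) (x) S(x_(1))_(2). *)
Lemma Delta_S (W : lmodType k) (F : H -> H -> W) x :
  bilin F -> sw (S x) F = sw x (fun u v => F (S v) (S u)).
Proof.
move=> bF.
transitivity (sw x (fun w v => sw w (fun u z =>
                 sw (S u) (fun p q => F (p * z * S v) q)))).
  rewrite (sweedler_coassoc (T := fun u z v =>
     sw (S u) (fun p q => F (p * z * S v) q))); last by_lin.
  rewrite -(sweedler_counitr (f := fun t => sw (S t) F)); last by_lin.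
  apply: eq_sweedler => u w.
  rewrite exchange_sweedler sweedlerZ; apply: eq_sweedler => p q.
  under [RHS]eq_sweedler => z v do rewrite -mulrA.
  by rewrite (sweedler_antipoder (f := fun t => F (p * t) q)) ?mulr1; last by_lin.
apply: eq_sweedler => w v.
under eq_sweedler => u z do [].
rewrite (Delta_S_aux (F := fun p q => F (p * S v) q)) ?mul1r //; by_lin.
Qed.

Section InverseAntipode.
Variable T : H -> H.
Hypotheses (ST : cancel S T) (TS : cancel T S).

Lemma lin_T : lin T.
Proof. by move=> c x y; apply: (can_inj ST); rewrite lin_S !TS. Qed.

Lemma T_mul x y : T (x * y) = T y * T x.
Proof. by apply: (can_inj ST); rewrite S_mul !TS. Qed.

Lemma Delta_T (W : lmodType k) (F : H -> H -> W) x :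
  bilin F -> sw (T x) F = sw x (fun u v => F (T v) (T u)).
Proof.
have lT := lin_T; move=> bF; rewrite -{2}[x]TS Delta_S; last by_lin.
by apply: eq_sweedler => u v; rewrite !ST.
Qed.
End InverseAntipode.

(** The coideal condition is in slice form, which avoids choosing a list that represents [Delta a];
    [coideal_rep] recovers such a list. *)
Record coideal_subalg (A : H -> Prop) : Prop := CoidealSubalg {
  coideal_subalg1 : A 1;
  coideal_subalg_sub : subspace A;
  coideal_subalgM : forall x y, A x -> A y -> A (x * y);
  coideal_subalg_slice : forall a f, A a -> klin f ->
    A (sw a (fun u v => f u *: v))
}.

(** * Coideal subalgebras: second legs can be taken in [A] *)

Section Coideal.
Variable A : H -> Prop.
Hypothesis hA : coideal_subalg A.
Let sA := coideal_subalg_sub hA.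

Section Projection.
Variable p : H -> H.
Hypotheses (lp : lin p) (Ap : forall x, A (p x)) (pA : forall x, A x -> p x = x).

(** By contraction only the slices f(a_(1)) a_(2) matter; they lie in [A], where [p] is the
    identity. *)
Lemma sweedler_proj (W : lmodType k) (F : H -> H -> W) a :
  bilin F -> A a -> sw a F = sw a (fun u v => F u (p v)).
Proof.
move=> bF Aa; apply/eqP; rewrite -subr_eq0 /sweedler -sumrB; apply/eqP.
apply: (contraction_eq0 (T := fun q h => F h q.2 - F h (p q.2)) (x := fst)).
  by move=> q c x y; rewrite !(bF.1 _ c) scalerBr opprD addrACA.
move=> f lf h.
transitivity (F h (sw a (fun u v => f u *: v) - p (sw a (fun u v => f u *: v)))).
  rewrite (sweedler_lin lp) /sweedler -sumrB (lin_sum (bF.2 h)).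
  apply: eq_bigr => q _.
  by rewrite (linZ lp) (linB (bF.2 h)) !(linZ (bF.2 h)) scalerBr.
by rewrite pA ?subrr ?(lin0 (bF.2 h)) //; apply: coideal_subalg_slice.
Qed.

Lemma coideal_rep_proj a : A a -> teq2 (Delta a) [seq (q.1, p q.2) | q <- Delta a].
Proof.
move=> Aa; apply: teq2I => f lf; rewrite big_map /=.
by apply: (sweedler_proj (F := fun u v => f u *: v)); first by_lin.
Qed.
End Projection.

Lemma coideal_rep a : A a ->
  exists s, teq2 (Delta a) s /\ forall q, q \in s -> A q.2.
Proof.
move=> Aa; have [p [lp Ap pA]] := linear_projection sA.
exists [seq (q.1, p q.2) | q <- Delta a]; split; first exact: coideal_rep_proj.
by move=> q /mapP[r _ ->]; apply: Ap.
Qed.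

Lemma eq_sweedler_coideal (W : lmodType k) (F G : H -> H -> W) a :
  bilin F -> bilin G -> (forall u v, A v -> F u v = G u v) -> A a ->
  sw a F = sw a G.
Proof.
move=> bF bG FG Aa; have [p [lp Ap pA]] := linear_projection sA.
rewrite (sweedler_proj lp pA bF Aa) (sweedler_proj lp pA bG Aa).
by apply: eq_sweedler => u v; apply: FG.
Qed.

Lemma sweedler_coideal_mem (W : lmodType k) (I : W -> Prop) (F : H -> H -> W) a :
  subspace I -> bilin F -> (forall u v, A v -> I (F u v)) -> A a -> I (sw a F).
Proof.
move=> sI bF IF Aa; have [p [lp Ap pA]] := linear_projection sA.
rewrite (sweedler_proj lp pA bF Aa); apply: (subspace_sum sI) => q; exact: IF.
Qed.

(** A cointegral is linear only on [A]; composed with a projection onto [A] it becomes a functional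
    on [H]. *)
Lemma cointegral1_extend phi : cointegral1 Delta A phi ->
  exists Phi : H -> k, [/\ klin Phi, forall a, A a -> Phi a = phi a &
    forall a, A a -> sw a (fun u v => Phi v *: u) = Phi a *: 1].
Proof.
move=> [philin phico]; have [p [lp Ap pA]] := linear_projection sA.
have klPhi : klin (fun x => phi (p x)) by move=> c x y; rewrite lp philin.
exists (fun x => phi (p x)); split=> // [a Aa|a Aa]; first by rewrite pA.
have [s [Ds As]] := coideal_rep Aa.
rewrite pA // -(phico _ _ Aa Ds As) /sweedler.
rewrite (teq2_bilin (F := fun u v => phi (p v) *: u) _ Ds); last by_lin.
by apply: eq_big_seq => q /As Aq; rewrite pA.
Qed.
End Coideal.

Lemma left_coideal_subalgP A : left_coideal_subalg Delta A -> coideal_subalg A.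
Proof.
case=> A1 AD AM AZ Aco; split=> // [|a f Aa lf].
  split=> [|c x y Ax Ay]; first by rewrite -(scale0r 1); apply: AZ.
  by apply: AD => //; apply: AZ.
have [s [Ds As]] := Aco a Aa.
rewrite /sweedler (teq2_bilin (F := fun u v => f u *: v) _ Ds); last by_lin.
rewrite big_seq; apply: (big_ind A) => [||q /As Aq] //; last exact: AZ.
by rewrite -(scale0r 1); apply: AZ.
Qed.

(** * The subalgebra attached to an element of integral type *)

Definition acts_as (L a b : H) : Prop :=
  teq2 (tmul2 (Delta a) [:: (1, L)]) [:: (b, L)].

Section ActsAs.
Variable L : H.

Lemma acts_asP a b : (forall f, klin f ->
  sw a (fun u v => f u *: (v * L)) = f b *: L) -> acts_as L a b.
Proof.
move=> h; apply: teq2I => f lf; rewrite big_seq1 -h // big_allpairs_dep.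
by apply: eq_bigr => q _; rewrite big_seq1 mulr1.
Qed.

Lemma acts_as_bilin (W : lmodType k) (F : H -> H -> W) a b :
  bilin F -> acts_as L a b -> sw a (fun u v => F u (v * L)) = F b L.
Proof.
move=> bF /(teq2_bilin bF); rewrite big_seq1 /= => <-; rewrite big_allpairs_dep.
by apply: eq_bigr => q _; rewrite big_seq1 mulr1.
Qed.

Lemma acts_as_eps a b : acts_as L a b -> a * L = eps b *: L.
Proof.
move=> h; rewrite -(acts_as_bilin (F := fun u v => eps u *: v) _ h); last by_lin.
by rewrite (sweedler_counitl (f := fun v => v * L)); last by_lin.
Qed.

(** Expand S(a_(1)) (a_(2) L)_(1) (x) (a_(2) L)_(2). The hypothesis turns it into S(b) L_(1) (x)
    L_(2); multiplicativity of the coproduct and the antipode axiom turn it into L_(1) (x) a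
    L_(2). *)
Lemma acts_as_casimir (W : lmodType k) (F : H -> H -> W) a b :
  bilin F -> acts_as L a b ->
  sw L (fun u v => F u (a * v)) = sw L (fun u v => F (S b * u) v).
Proof.
move=> bF h.
rewrite -(acts_as_bilin (F := fun x y => sw y (fun u v => F (S x * u) v)) _ h);
  last by_lin.
under [RHS]eq_sweedler => x y do (rewrite sweedlerM; last by_lin).
rewrite -(sweedler_coassoc (T := fun x y z =>
  sw L (fun u v => F (S x * (y * u)) (z * v)))); last by_lin.
under [RHS]eq_sweedler => w z.
  under eq_sweedler => x y do under eq_sweedler => u v do rewrite mulrA.
  rewrite (sweedler_antipodel (f := fun t => sw L (fun u v => F (t * u) (z * v))));
    last by_lin.
  under [X in _ *: X]eq_sweedler => u v do rewrite mul1r.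
  over.
by rewrite sweedler_counitl; last by_lin.
Qed.
End ActsAs.

Section IntegralType.
Variable L : H.

Lemma A_of_coideal_subalg : coideal_subalg (A_of Delta L).
Proof.
split=> [||x y [b hb] [c hc]|a f [b hb] lf].
- by exists 1; apply: acts_asP => f lf; rewrite sweedler1 ?mul1r //; by_lin.
- split=> [|c x y [b hb] [d hd]].
    exists 0; apply: acts_asP => f lf.
    rewrite (klin0 lf) scale0r (lin0 (f := fun x => sw x (fun u v => f u *: (v * L)))) //.
    by by_lin.
  exists (c *: b + d); apply: acts_asP => f lf.
  have bF : bilin (fun u v : H => f u *: (v * L)) by by_lin.
  have bG : bilin (fun u v : H => f u *: v) by by_lin.
  rewrite (lin_sweedler_arg bF (@lin_id _ H)) lf scalerDl -scalerA.
  by rewrite (acts_as_bilin bG hb) (acts_as_bilin bG hd).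
- exists (b * c); apply: acts_asP => f lf.
  rewrite sweedlerM; last by_lin.
  under eq_sweedler => u v.
    under eq_sweedler => p q do rewrite -mulrA.
    rewrite (acts_as_bilin (F := fun p q => f (u * p) *: (v * q)) _ hc); last by_lin.
    over.
  by rewrite (acts_as_bilin (F := fun u v => f (u * c) *: v) _ hb); last by_lin.
(* Comultiplying the first leg of a_(1) (x) a_(2) L = b (x) L shows that a slice of [a] is witnessed
   by the same slice of [b]. *)
- exists (sw b (fun u v => f u *: v)); apply: acts_asP => g lg.
  have bF : bilin (fun u v : H => g u *: (v * L)) by by_lin.
  rewrite (sweedler_lin (lin_sweedler_arg bF (@lin_id _ H))) (sweedler_klin lg).
  rewrite -(acts_as_bilin (F := fun x z => sw x (fun u v => g (f u *: v) *: z)) _ hb);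
    last by_lin.
  rewrite (sweedler_coassoc (T := fun u v z => g (f u *: v) *: (z * L))); last by_lin.
  apply: eq_sweedler => u v.
  rewrite (linZ (lin_sweedler_arg bF (@lin_id _ H))) sweedlerZ.
  by apply: eq_sweedler => x y; rewrite (klinZ lg) scalerA.
Qed.

Hypothesis hL : integral_type Delta L.
Let L0 : L != 0 := hL.1.
Let LL : acts_as L L L := hL.2.

(* If [a] acts on [L] as [b], then [eps (b) L = S (b) L] follows by applying
   the Casimir property of [L] and then multiplying the second leg by [L];
   this is nothing but [eps (a) L]. *)
Lemma A_of_integral a : A_of Delta L a -> a * L = eps a *: L.
Proof.
case=> b hb; have [f lf fL] := separating_functional L0.
rewrite (acts_as_eps hb).
transitivity (sw L (fun u v => f (a * v * L) *: u)).
  under eq_sweedler => u v do rewrite -mulrA.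
  rewrite (acts_as_bilin (F := fun u v => f (a * v) *: u) _ LL); last by_lin.
  by rewrite (acts_as_eps hb) (klinZ lf) fL mulr1.
rewrite (acts_as_casimir (F := fun u v => f (v * L) *: u) _ hb); last by_lin.
rewrite (acts_as_bilin (F := fun u v => f v *: (S b * u)) _ LL); last by_lin.
rewrite fL scale1r -(acts_as_bilin (F := fun u v => S u * v) _ hb); last by_lin.
under eq_sweedler => u v do rewrite mulrA.
by rewrite (sweedler_antipodel (f := fun t => t * L)) ?mul1r //; by_lin.
Qed.
End IntegralType.

(** S^2 and its inverse respect products and coproducts and fix [L], so they preserve the relation
    that defines [A_of]. *)
Lemma S2_stable_A_of L : S L = L -> S2_stable S (A_of Delta L).
Proof.
move=> SL; have [T ST TS] := S_bij hH; have lT := lin_T ST TS.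
have TL : T L = L by rewrite -{1}SL ST.
move=> x; split=> [[b hb]|[y [[b hb] ->]]].
  exists (T (T x)); rewrite !TS; split=> //.
  exists (T (T b)); apply: acts_asP => f lf.
  rewrite !(Delta_T ST TS); try by_lin.
  under eq_sweedler => u v.
    have -> : T (T v) * L = T (T (v * L)) by rewrite !(T_mul ST TS) !TL.
    over.
  rewrite (acts_as_bilin (F := fun u v => f (T (T u)) *: T (T v)) _ hb) ?TL //.
  by by_lin.
exists (S (S b)); apply: acts_asP => f lf.
rewrite !Delta_S; try by_lin.
under eq_sweedler => u v.
  have -> : S (S v) * L = S (S (v * L)) by rewrite !S_mul !SL.
  over.
rewrite (acts_as_bilin (F := fun u v => f (S (S u)) *: S (S v)) _ hb) ?SL //.
by by_lin.
Qed.

(** * Integrals and cointegrals on a coideal subalgebra *)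

Section Integral.
Variables (A : H -> Prop) (L : H).
Hypotheses (hA : coideal_subalg A) (AL : A L).
Hypothesis intL : forall a, A a -> a * L = eps a *: L.

(** Second legs of [a] lie in [A], so [L] absorbs them through [eps]. For [L] of integral type and
    [a] in [A_of], the witness can thus be [a] itself. *)
Lemma integral_acts_as a : A a -> acts_as L a a.
Proof.
move=> Aa; apply: acts_asP => f lf.
rewrite (eq_sweedler_coideal hA (G := fun u v => eps v *: (f u *: L)) _ _ _ Aa).
- by rewrite (sweedler_counitr (f := fun u => f u *: L)); last by_lin.
- by by_lin.
- by by_lin.
- by move=> u v /intL ->; rewrite !scalerA mulrC.
Qed.

Section Cointegral.
Variable Phi : H -> k.
Hypothesis lPhi : klin Phi.
Hypothesis coPhi : forall a, A a -> sw a (fun u v => Phi v *: u) = Phi a *: 1.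

(** The Casimir property moves [a] out of [Phi] as a left factor [S a]; the cointegral property at
    [L] does the rest. *)
Lemma cointegral_integral a : A a ->
  sw L (fun u v => Phi (a * v) *: u) = Phi L *: S a.
Proof.
move=> Aa.
rewrite (acts_as_casimir (F := fun u v => Phi v *: u) _ (integral_acts_as Aa));
  last by_lin.
under eq_sweedler => u v do rewrite scalerAr.
by rewrite -(sweedler_lin (lin_mull (S a) (@lin_id _ H))) coPhi // -scalerAr mulr1.
Qed.

(** At [a = L] in [cointegral_integral], right invariance turns Phi(L L_(2)) L_(1) into Phi(L) L. *)
Lemma S_integral : Phi L != 0 -> (forall a, A a -> L * a = eps a *: L) -> S L = L.
Proof.
move=> PL0 intR; apply: (scalerI PL0); rewrite -(cointegral_integral AL).
rewrite (eq_sweedler_coideal hA (G := fun u v => eps v *: (Phi L *: u)) _ _ _ AL).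
- by rewrite (sweedler_counitr (f := fun u => Phi L *: u)); last by_lin.
- by by_lin.
- by by_lin.
- by move=> u v /intR ->; rewrite (klinZ lPhi) scalerA.
Qed.
End Cointegral.
End Integral.

(** For a basis [w] this is the fact that a square matrix with trivial left kernel has trivial right
    kernel. Here [w] only spans [A], so both kernels of the Gram matrix [G] are compared with the
    left kernel of [M], the space of linear relations among the [w i]. *)
Lemma dual_bases_nondegenerate (A : H -> Prop) (Phi : H -> k) n (v w : 'I_n -> H) :
  subspace A -> klin Phi -> (forall i, A (w i)) ->
  (forall a, A a -> a = \sum_i Phi (a * v i) *: w i) ->
  (forall a, A a -> (forall b, A b -> Phi (a * b) = 0) -> a = 0) ->
  forall y, A y -> (forall a, A a -> Phi (a * y) = 0) -> y = 0.
Proof.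
move=> sA lPhi Aw aE faith y Ay Phiy.
(* Row i of [M] and the row [d] hold coefficients of [w i] and [y] along [w]; this gives d M = d
   below. *)
pose M := \matrix_(i, j) Phi (w i * v j).
pose G := \matrix_(i, j) Phi (w i * w j).
pose d := \row_j Phi (y * v j).
have PhiMl (c : 'I_n -> k) (z : 'I_n -> H) x :
    Phi ((\sum_i c i *: z i) * x) = \sum_i c i * Phi (z i * x).
  rewrite mulr_suml (klin_sum lPhi); apply: eq_bigr => i _.
  by rewrite -scalerAl (klinZ lPhi).
have PhiMr (c : 'I_n -> k) (z : 'I_n -> H) x :
    Phi (x * (\sum_i c i *: z i)) = \sum_i c i * Phi (x * z i).
  rewrite mulr_sumr (klin_sum lPhi); apply: eq_bigr => i _.
  by rewrite -scalerAr (klinZ lPhi).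
have GMT : G^T = M *m G^T.
  apply/matrixP=> i j; rewrite !mxE {1}(aE _ (Aw i)) PhiMr.
  by apply: eq_bigr => l _; rewrite !mxE.
have kerGM : (kermx G <= kermx M)%MS.
  apply/sub_kermxP/row_matrixP => i; rewrite row_mul row0.
  have : row i (kermx G) *m G = 0 by rewrite -row_mul mulmx_ker row0.
  move: (row i _) => c cG.
  have c0 : \sum_i c 0 i *: w i = 0.
    apply: faith => [|b Ab].
      by apply: subspace_sum => // j; apply: subspaceZ.
    rewrite (aE _ Ab) PhiMr big1 // => j _; rewrite PhiMl.
    have /matrixP/(_ 0 j) := cG; rewrite !mxE => cGj.
    by under eq_bigr => l _ do [have -> : Phi (w l * w j) = G l j by rewrite mxE];
      rewrite cGj mulr0.
  apply/rowP=> j; rewrite !mxE -[RHS](klin0 lPhi) -[0 in RHS](mul0r (v j)) -c0 PhiMl.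
  by apply: eq_bigr => l _; rewrite !mxE.
have rMG : (\rank M <= \rank G)%N.
  have := mxrankS kerGM; rewrite !mxrank_ker.
  by have := rank_leq_row M; have := rank_leq_row G; lia.
have kerMG : (kermx M <= kermx G^T)%MS.
  by apply/sub_kermxP; rewrite GMT mulmxA mulmx_ker mul0mx.
(* The inclusion [kerMG] is an equality by dimension: [G] and its transpose have the same rank, at
   least that of [M]. *)
have kerGTM : (kermx G^T <= kermx M)%MS.
  rewrite -(mxrank_leqif_sup kerMG) !mxrank_ker mxrank_tr.
  by have := mxrankS kerMG; rewrite !mxrank_ker mxrank_tr; lia.
have yE : y = \sum_j d 0 j *: w j.
  by rewrite {1}(aE y Ay); apply: eq_bigr => j _; rewrite mxE.
have dG : d *m G^T = 0.
  apply/rowP=> i; rewrite !mxE -[RHS](Phiy _ (Aw i)) [in RHS]yE PhiMr.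
  by apply: eq_bigr => j _; rewrite !mxE.
have dM : d *m M = 0.
  by apply/sub_kermxP; apply: submx_trans kerGTM; apply/sub_kermxP.
have dM' : d *m M = d.
  apply/rowP=> j; rewrite !mxE [in RHS]yE PhiMl.
  by apply: eq_bigr => l _; rewrite !mxE.
by rewrite yE big1 // => j _; rewrite -dM' dM mxE scale0r.
Qed.

(** * Consequences of a faithful cointegral *)

Section FaithfulCointegral.
Variables (A : H -> Prop) (Phi : H -> k).
Hypotheses (hA : coideal_subalg A) (lPhi : klin Phi).
Hypothesis coPhi : forall a, A a -> sw a (fun u v => Phi v *: u) = Phi a *: 1.
Hypothesis faithPhi : faithful A Phi.
Let sA := coideal_subalg_sub hA.
Let AM := coideal_subalgM hA.

(** Applying S^-1 to [cointegral_integral] at [x] gives Phi(x) a = Phi(a x_(2)) S^-1(x_(1)), that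
    is, dual bases for the form. *)
Lemma cointegral_nondegenerate x :
  A x -> (forall a, A a -> a * x = eps a *: x) -> Phi x != 0 ->
  forall y, A y -> (forall a, A a -> Phi (a * y) = 0) -> y = 0.
Proof.
move=> Ax intx Px0.
have [T ST TS] := S_bij hH; have lT := lin_T ST TS.
have [p [lp Ap pA]] := linear_projection sA.
pose e := tnth (in_tuple (Delta x)).
(* The elements S^-1(x_(1)) need not lie in [A]; [p] moves them there and fixes their combination, a
   multiple of [a]. *)
apply: (dual_bases_nondegenerate (v := fun i => (e i).2)
          (w := fun i => (Phi x)^-1 *: p (T (e i).1)) sA lPhi _ _ faithPhi).
  by move=> i; apply: subspaceZ.
move=> a Aa; apply: (scalerI Px0); rewrite -{1}(pA _ Aa) -{1}(ST a).
rewrite -(linZ lp) -(linZ lT) -(cointegral_integral hA Ax intx lPhi coPhi Aa).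
rewrite (sweedler_lin lT) (sweedler_lin lp) /sweedler big_tnth scaler_sumr.
apply: eq_bigr => i _; rewrite (linZ lT) (linZ lp) !scalerA; congr (_ *: _).
by rewrite mulrAC mulfV ?mul1r.
Qed.

Section Integral.
Variable L : H.
Hypotheses (AL : A L) (L0 : L != 0).
Hypothesis intL : forall a, A a -> a * L = eps a *: L.

Lemma cointegral_integral_neq0 : Phi L != 0.
Proof.
apply/eqP => PL; have [b Ab PLb] : exists2 b, A b & Phi (L * b) != 0.
  apply: contrapT => nb; case/eqP: L0; apply: faithPhi => // b Ab.
  by apply/eqP; apply: contrapT => /negP Pb; apply: nb; exists b.
case/eqP: L0; apply: (cointegral_nondegenerate (AM AL Ab) _ PLb) => // a Aa.
  by rewrite mulrA intL // scalerAl.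
by rewrite intL // (klinZ lPhi) PL mulr0.
Qed.

Lemma integral_right : L * L = L -> forall a, A a -> L * a = eps a *: L.
Proof.
move=> LL a Aa; have PL0 := cointegral_integral_neq0.
have ALa := AM AL Aa.
(* [L * a] is a left integral too; the scalar makes [Phi] vanish on the difference, which is then
   orthogonal to [A]. *)
have /eqP : L * a - (Phi (L * a) / Phi L) *: L = 0.
  apply: (cointegral_nondegenerate AL intL PL0) => [|b Ab].
    by apply: subspaceB => //; apply: subspaceZ.
  rewrite mulrBr mulrA intL // -scalerAl -scalerAr intL //.
  by rewrite (klinB lPhi) !(klinZ lPhi) mulrCA divfK // subrr.
rewrite subr_eq0 => /eqP LaE.
(* Right multiplication by the idempotent [L] identifies the scalar as [eps a]. *)
have := congr1 ( *%R^~ L) LaE; rewrite -mulrA intL // -scalerAr -scalerAl LL.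
by move/(scaler_injr L0) => ->.
Qed.
End Integral.
End FaithfulCointegral.

(** * Normalized integrals: unimodularity, group-like projections, Maschke *)

Section TwoSidedIntegral.
Variables (A : H -> Prop) (L : H).
Hypotheses (hA : coideal_subalg A) (AL : A L) (eL : eps L = 1).
Hypothesis intL : forall a, A a -> a * L = eps a *: L.
Let sA := coideal_subalg_sub hA.
Let A1 := coideal_subalg1 hA.
Let AM := coideal_subalgM hA.

(** One product of [x] and [L], evaluated by the invariance of each factor, gives x = eps(x) L. *)
Lemma two_sided_integral_unimodular :
  (forall a, A a -> L * a = eps a *: L) -> unimodular eps A.
Proof.
move=> intR x; split=> [[Ax intx]|[Ax intx]]; split=> // a Aa.
  have xE : x = eps x *: L by rewrite -(intR x Ax) intx // eL scale1r.
  by rewrite xE -scalerAl intR // !scalerA mulrC.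
have xE : x = eps x *: L by rewrite -(intL Ax) intx // eL scale1r.
by rewrite xE -scalerAr intL // !scalerA mulrC.
Qed.

Lemma integral_two_sided_glp : S L = L ->
  (forall a, A a -> L * a = eps a *: L) -> two_sided_glp Delta L.
Proof.
move=> SL intR.
have trade (F G : H -> H -> H) : bilin F -> bilin G ->
    (forall u v, A v -> F u v = eps v *: G u L) -> sw L F = G L L.
  move=> bF bG FG.
  rewrite -(sweedler_counitr (f := fun u => G u L)); last by_lin.
  by apply: (eq_sweedler_coideal hA) => //; by_lin.
split.
- apply/eqP => L0; move: eL; rewrite L0 (klin0 klin_eps) => /eqP.
  by rewrite eq_sym oner_eq0.
- by rewrite intL // eL scale1r.
- split; first exact: (integral_acts_as hA intL).
  apply: teq2I => f lf; rewrite big_seq1 big_allpairs_dep big_seq1 /=.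
  under eq_bigr => q _ do rewrite mul1r.
  apply: (trade (fun u v => f u *: (L * v)) (fun u v => f u *: v)).
  + by by_lin.
  + by by_lin.
  + by move=> u v /intR ->; rewrite !scalerA mulrC.
- apply: teq2I => f lf; rewrite big_seq1 big_allpairs_dep /=.
  under eq_bigr => q _ do rewrite big_seq1 mulr1.
  (* First legs of [L] need not lie in [A]. Writing [L] as [S L] replaces them by [S] of second
     legs, so that [trade] applies. *)
  transitivity (sw (S L) (fun u v => f (u * L) *: v)); first by rewrite SL.
  rewrite Delta_S; last by_lin.
  transitivity (f (S L) *: S L); last by rewrite SL.
  apply: (trade (fun u v => f (S v * L) *: S u) (fun u v => f (S v) *: S u)).
  + by by_lin.
  + by by_lin.
  + move=> u v Av; rewrite -{1}SL -S_mul intR //.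
    by rewrite (linZ lin_S) (klinZ lf) scalerA.
- apply: teq2I => f lf; rewrite big_seq1 big_allpairs_dep big_seq1 /=.
  under eq_bigr => q _ do rewrite mul1r.
  transitivity (sw (S L) (fun u v => f (L * u) *: v)); first by rewrite SL.
  rewrite Delta_S; last by_lin.
  transitivity (f (S L) *: S L); last by rewrite SL.
  apply: (trade (fun u v => f (L * S v) *: S u) (fun u v => f (S v) *: S u)).
  + by by_lin.
  + by by_lin.
  + move=> u v Av; rewrite -{1}SL -S_mul intL //.
    by rewrite (linZ lin_S) (klinZ lf) scalerA.
Qed.

Lemma left_ideal_subspace I : left_ideal A I -> subspace I.
Proof.
case=> _ I0 ID _ IM; split=> // c x y Ix Iy; apply: ID => //.
by rewrite -[x]mul1r scalerAl; apply: IM => //; apply: subspaceZ.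
Qed.

(* Maschke averaging [a |-> L_(2) q (S^-1 (L_(1)) a)] of a linear projection
   [q] onto the left ideal. *)
Lemma integral_semisimple : S L = L -> semisimple A.
Proof.
move=> SL I hI; have sI := left_ideal_subspace hI; have [IA I0 ID IN IM] := hI.
have [T ST TS] := S_bij hH; have lT := lin_T ST TS.
have [q [lq Iq qI]] := linear_projection sI.
pose P a := sw L (fun u v => v * q (T u * a)).
have lP : lin P by rewrite /P; by_lin.
have IP a : I (P a).
  by apply: (sweedler_coideal_mem hA sI _ _ AL) => [|u v Av]; [by_lin | apply: IM].
have PM b a : A b -> P (b * a) = b * P a.
  move=> Ab; rewrite /P (sweedler_lin (lin_mull b (@lin_id _ H))).
  under [RHS]eq_sweedler => u v do rewrite mulrA.
  rewrite (acts_as_casimir (F := fun u v => v * q (T u * a)) _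
             (integral_acts_as hA intL Ab)); last by_lin.
  by apply: eq_sweedler => u v; rewrite (T_mul ST TS) ST mulrA.
(* Writing [L] as [S L] turns S^-1(L_(1)) into L_(2), which lies in [A]; so [q] acts as the identity
   and S(L_(1)) L_(2) x = x remains. *)
have PI x : I x -> P x = x.
  move=> Ix; rewrite /P -SL Delta_S; last by_lin.
  rewrite (eq_sweedler_coideal hA (G := fun u v => S u * v * x) _ _ _ AL).
  - by rewrite (sweedler_antipodel (f := fun t => t * x)) ?mul1r ?eL ?scale1r //; by_lin.
  - by by_lin.
  - by by_lin.
  - by move=> u v Av; rewrite ST qI ?mulrA //; apply: IM.
exists (fun a => A a /\ P a = 0); split.
- split=> [x []||x y [Ax Px] [Ay Py]|x [Ax Px]|a x Aa [Ax Px]] //.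
  + by split; [case: sA | apply: lin0].
  + by split; [apply: subspaceD | rewrite (linD lP) Px Py addr0].
  + by split; [rewrite -scaleN1r; apply: subspaceZ | rewrite (linN lP) Px oppr0].
  + by split; [apply: AM | rewrite PM // Px mulr0].
- by move=> x Ix [_ Px]; rewrite -(PI x).
- move=> a Aa; exists (P a), (a - P a); split=> //; last by rewrite addrC subrK.
  split; first by apply: subspaceB => //; apply: IA.
  by rewrite (linB lP) [P (P a)]PI // subrr.
Qed.
End TwoSidedIntegral.

(** * Cointegrals on semisimple coideal subalgebras *)

Section Semisimple.
Variable A : H -> Prop.
Hypotheses (hA : coideal_subalg A) (ssA : semisimple A) (S2A : S2_stable S A).
Let sA := coideal_subalg_sub hA.
Let A1 := coideal_subalg1 hA.
Let AM := coideal_subalgM hA.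

Lemma A_S2 x : A x -> A (S (S x)).
Proof. by move=> Ax; apply/S2A; exists x. Qed.

(** Split 1 = n + m along [N] and a complement; then x = x n + x m = x m lies in both. *)
Lemma semisimple_sqr0 (N : H -> Prop) : left_ideal A N ->
  (forall x y, N x -> N y -> x * y = 0) -> forall x, N x -> x = 0.
Proof.
move=> hN NN x Nx; have [NA N0 ND NN' NM] := hN.
have [K [[KA K0 KD KN KM] NK /(_ 1 A1)[n [m [Nn Km e1]]]]] := ssA hN.
apply: NK => //; rewrite -[x]mulr1 e1 mulrDr NN // add0r.
by apply: KM => //; apply: NA.
Qed.

Lemma semisimple_integral : exists L,
  [/\ A L, eps L = 1, forall a, A a -> a * L = eps a *: L &
      forall a, A a -> L * a = eps a *: L].
Proof.
pose I x := A x /\ eps x = 0.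
have hI : left_ideal A I.
  split=> [x []||x y [Ax ex] [Ay ey]|x [Ax ex]|a x Aa [Ax ex]] //.
  - by split; [case: sA | apply: (klin0 klin_eps)].
  - by split; [apply: subspaceD | rewrite (klinD klin_eps) ex ey addr0].
  - rewrite -scaleN1r; split; first exact: (subspaceZ sA).
    by rewrite (klinZ klin_eps) ex mulr0.
  - by split; [apply: AM | rewrite (eps_mul hH) ex mulr0].
have [J [hJ IJ /(_ 1 A1)[i [L [[Ai ei] JL e1]]]]] := ssA hI.
have [JA _ _ _ JM] := hJ; have AL := JA _ JL.
have eL : eps L = 1 by rewrite -(eps_one hH) e1 (klinD klin_eps) ei add0r.
have intL a : A a -> a * L = eps a *: L.
  move=> Aa; apply/eqP; rewrite -subr_eq0; apply/eqP; apply: IJ.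
    split; first by apply: subspaceB; [| apply: AM | apply: subspaceZ].
    by rewrite (klinB klin_eps) (klinZ klin_eps) (eps_mul hH) eL subrr.
  have sJ := left_ideal_subspace hA hJ.
  by apply: subspaceB => //; [apply: JM | apply: subspaceZ].
(* L ker(eps) is a left ideal, and its square vanishes because c L = 0 for c in ker(eps). *)
have LI b : I b -> L * b = 0.
  move=> Ib; pose N x := exists2 b, I b & x = L * b.
  apply: (@semisimple_sqr0 N) => [||]; last by exists b.
    have sI := left_ideal_subspace hA hI.
    split=> [_ [c [Ac _] ->]||_ _ [c Ic ->] [d Id ->]|_ [c Ic ->]|a _ Aa [c Ic ->]].
    - exact: AM.
    - by exists 0; rewrite ?mulr0 //; case: sI.
    - by exists (c + d); rewrite ?mulrDr //; apply: (subspaceD sI).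
    - exists (-1 *: c); first exact: (subspaceZ sI).
      by rewrite -scalerAr scaleN1r.
    - exists (eps a *: c); first exact: (subspaceZ sI).
      by rewrite mulrA intL // -scalerAl scalerAr.
  move=> _ _ [c [Ac ec] ->] [d Id ->].
  by rewrite mulrA -[L * c * L]mulrA intL // ec scale0r mulr0 mul0r.
exists L; split=> // a Aa.
have : L * (a - eps a *: 1) = 0.
  apply: LI; split; first by apply: subspaceB => //; apply: subspaceZ.
  by rewrite (klinB klin_eps) (klinZ klin_eps) (eps_one hH) mulr1 subrr.
by rewrite mulrBr -scalerAr mulr1 => /eqP; rewrite subr_eq0 => /eqP.
Qed.

Section Integral.
Variable L : H.
Hypotheses (AL : A L) (eL : eps L = 1).
Hypothesis intL : forall a, A a -> a * L = eps a *: L.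
Hypothesis intR : forall a, A a -> L * a = eps a *: L.

(** S(S L) is again a normalized left integral, and L S(S L) equals both factors. *)
Lemma S2_integral : S (S L) = L.
Proof.
have int2 a : A a -> a * S (S L) = eps a *: S (S L).
  move=> /S2A[b [Ab ->]].
  by rewrite -!S_mul (intL Ab) !(linZ lin_S) !eps_S.
by rewrite -[LHS]scale1r -eL -(int2 _ AL) (intR (A_S2 AL)) !eps_S eL scale1r.
Qed.

(* [S L * L = L], and [S] exchanges [S L * L] with [S L * S (S L)]. *)
Lemma S_semisimple_integral : S L = L.
Proof.
have SLL : S L * L = L.
  transitivity (sw L (fun u v => S u * (v * L))).
    by rewrite (acts_as_bilin (F := fun u v => S u * v) _ (integral_acts_as hA intL AL)) //;
      by_lin.
  under eq_sweedler => u v do rewrite mulrA.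
  rewrite (sweedler_antipodel (f := fun t => t * L)); last by_lin.
  by rewrite mul1r eL scale1r.
by rewrite -[RHS]SLL -{3}S2_integral -S_mul SLL.
Qed.

(** The smallest subspace V such that [Delta L] lies in H (x) V. *)
Definition right_leg (x : H) : Prop :=
  exists2 f : H -> k, klin f & x = sw L (fun u v => f u *: v).

Lemma right_leg_ideal : left_ideal A right_leg.
Proof.
split=> [_ [f lf ->]||_ _ [f lf ->] [g lg ->]|_ [f lf ->]|a _ Aa [f lf ->]].
- exact: coideal_subalg_slice.
- exists (fun _ => 0) => [c x y|]; first by rewrite mulr0 addr0.
  by rewrite /sweedler big1 // => q _; rewrite scale0r.
- exists (fun x => f x + g x) => [c x y|].
    by rewrite lf lg mulrDr addrACA.
  by rewrite /sweedler -big_split; apply: eq_bigr => q _; rewrite scalerDl.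
- exists (fun x => - f x) => [c x y|]; first by rewrite lf opprD mulrN.
  by rewrite /sweedler -sumrN; apply: eq_bigr => q _; rewrite scaleNr.
- have lSa : klin (fun u => f (S a * u)) by apply: (klin_comp lf); by_lin.
  exists (fun u => f (S a * u)) => //.
  rewrite (sweedler_lin (lin_mull a (@lin_id _ H))).
  under eq_sweedler => u v do rewrite -scalerAr.
  by rewrite (acts_as_casimir (F := fun u v => f u *: v) _
               (integral_acts_as hA intL Aa)); last by_lin.
Qed.

(** Stability under S^2 gives a = S(S b). After [S L = L] swaps the legs, S(u) S(S b) = S(S(b) u),
    and the Casimir property moves [b] to the leg seen by [f]. *)
Lemma right_leg_mulr x a : right_leg x -> A a -> right_leg (x * a).
Proof.
move=> [f lf ->] /S2A[b [Ab ->]].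
have lSb : klin (fun u => f (u * S b)) by apply: (klin_comp lf); by_lin.
exists (fun u => f (u * S b)) => //.
rewrite (sweedler_lin (lin_mulr _ (@lin_id _ H))).
rewrite -{1}S_semisimple_integral Delta_S; last by_lin.
under eq_sweedler => u v do rewrite -scalerAl -S_mul.
rewrite -(acts_as_casimir (F := fun u v => f (S v) *: S u) _
            (integral_acts_as hA intL Ab)); last by_lin.
rewrite -[in RHS]S_semisimple_integral Delta_S; last by_lin.
by apply: eq_sweedler => u v; rewrite S_mul.
Qed.

Lemma right_leg1 : right_leg 1.
Proof.
have [T ST TS] := S_bij hH.
have [VA V0 VD VN VM] := right_leg_ideal.
have [J [hJ VJ /(_ 1 A1)[x [j [Vx Jj ->]]]]] := ssA right_leg_ideal.
have [JA J0 JD JN JM] := hJ.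
(* The product lies in both ideals, [right_leg] being two-sided. *)
have VJ0 v i : right_leg v -> J i -> v * i = 0.
  move=> Vv Ji; apply: VJ; first exact: right_leg_mulr (JA _ Ji).
  by apply: JM => //; apply: VA.
(* J v is a left ideal whose square vanishes by [VJ0]. *)
have JV0 v : right_leg v -> forall i, J i -> i * v = 0.
  move=> Vv i Ji; pose N y := exists2 i, J i & y = i * v.
  apply: (@semisimple_sqr0 N) => [||]; last by exists i.
    split=> [_ [l Jl ->]||_ _ [l Jl ->] [m Jm ->]|_ [l Jl ->]|a _ Aa [l Jl ->]].
    - by apply: AM; [apply: JA | apply: VA].
    - by exists 0; rewrite ?mul0r.
    - by exists (l + m); rewrite ?mulrDl //; apply: JD.
    - by exists (- l); rewrite ?mulNr //; apply: JN.
    - by exists (a * l); rewrite ?mulrA //; apply: JM.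
  move=> _ _ [l Jl ->] [m Jm ->].
  by rewrite mulrA -[l * v * m]mulrA (VJ0 _ _ Vv Jm) mulr0 mul0r.
suff -> : j = 0 by rewrite addr0.
rewrite -[j]ST; suff -> : S j = 0 by rewrite (lin0 (lin_T ST TS)).
have lj := lin_mull j (@lin_id _ H).
(* Evaluate L_(1) S(j L_(2)) twice: the Casimir property gives S(j), while [JV0] annihilates every
   slice. *)
transitivity (sw L (fun u v => u * S (j * v))).
  rewrite (acts_as_casimir (F := fun u v => u * S v) _
             (integral_acts_as hA intL (JA _ Jj))); last by_lin.
  under eq_sweedler => u v do rewrite -mulrA.
  by rewrite (sweedler_antipoder (f := fun t => S j * t)) ?mulr1 ?eL ?scale1r //; by_lin.
apply: (contraction_eq0 (T := fun q h => h * S (j * q.2)) (x := fst)).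
  by move=> q; by_lin.
move=> f lf h.
transitivity (h * S (j * sw L (fun u v => f u *: v))).
  have lh : lin (fun y => h * S (j * y)) by by_lin.
  by rewrite (sweedler_lin lh); apply: eq_bigr => q _; rewrite (linZ lh).
have Vf : right_leg (sw L (fun u v => f u *: v)) by exists f.
by rewrite (JV0 _ Vf _ Jj) (lin0 lin_S) mulr0.
Qed.

Lemma semisimple_cointegral :
  exists phi, [/\ cointegral1 Delta A phi, faithful A phi &
       forall psi, cointegral1 Delta A psi ->
         exists c : k, forall a, A a -> psi a = c * phi a].
Proof.
have [T ST TS] := S_bij hH; have lT := lin_T ST TS.
have [f lf f1] := right_leg1.
pose phi x := f (T x).
have lphi : klin phi by apply: (klin_comp lf).
have phi1 : sw L (fun u v => phi v *: u) = 1.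
  rewrite -{1}S_semisimple_integral Delta_S; last by_lin.
  rewrite -S_one f1 (sweedler_lin lin_S); apply: eq_sweedler => u v.
  by rewrite (linZ lin_S) /phi ST.
have slice a : A a -> exists2 g : H -> k, klin g & a = sw L (fun u v => g u *: v).
  by case: right_leg_ideal => _ _ _ _ VM Aa; rewrite -[a]mulr1; apply: VM right_leg1.
(* Apply [g] to phi(L_(2)) L_(1) = 1. *)
have phiE g : klin g -> phi (sw L (fun u v => g u *: v)) = g 1.
  move=> lg; apply: (scaler_injr (oner_neq0 H)).
  rewrite (sweedler_klin lphi) -phi1 (sweedler_klin lg).
  by apply: eq_sweedler => u v; rewrite (klinZ lphi) (klinZ lg) mulrC.
(* For a = g(L_(1)) L_(2), coassociativity turns the left side into the [g]-slice of the coproduct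
   of phi(L_(2)) L_(1) = 1. *)
have cophi a : A a -> sw a (fun u v => phi v *: u) = phi a *: 1.
  move=> /slice[g lg ->]; rewrite (phiE g lg).
  have bF : bilin (fun u v : H => phi v *: u) by by_lin.
  have bG : bilin (fun u v : H => g u *: v) by by_lin.
  rewrite (sweedler_lin (lin_sweedler_arg bF (@lin_id _ H))).
  under eq_sweedler => u v.
    rewrite (linZ (lin_sweedler_arg bF (@lin_id _ H))) sweedlerZ.
    over.
  rewrite -(sweedler_coassoc (T := fun x y z => g x *: (phi z *: y))); last by_lin.
  transitivity (sw 1 (fun u v => g u *: v)); last by rewrite sweedler1.
  rewrite -phi1 (sweedler_lin (lin_sweedler_arg bG (@lin_id _ H))).
  apply: eq_sweedler => u v.
  rewrite (linZ (lin_sweedler_arg bG (@lin_id _ H))) sweedlerZ.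
  by apply: eq_sweedler => x y; rewrite !scalerA mulrC.
have phiL : phi L = 1.
  apply: (scaler_injr (oner_neq0 H)); rewrite scale1r -cophi //.
exists phi; split.
- split=> [c x y _ _|a s Aa Ds As]; first exact: lphi.
  rewrite -(cophi a Aa) /sweedler.
  by rewrite (teq2_bilin (F := fun u v => phi v *: u) _ Ds) //; by_lin.
(* S(a) = phi(L) S(a) = phi(a L_(2)) L_(1), and this vanishes. *)
- move=> a Aa phia; apply: (can_inj ST); rewrite (lin0 lin_S) -[S a]scale1r -phiL.
  rewrite -(cointegral_integral hA AL intL lphi cophi Aa).
  rewrite (eq_sweedler_coideal hA (G := fun _ _ => 0) _ _ _ AL).
  + by rewrite /sweedler big1.
  + by by_lin.
  + by split=> v c x y; rewrite scaler0 addr0.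
  + by move=> u v Av; rewrite phia // scale0r.
- move=> psi /(cointegral1_extend hA)[Psi [lPsi PsiE coPsi]].
  (* For a = g(L_(1)) L_(2), psi(a) = g(psi(L_(2)) L_(1)) = psi(L) g(1), and g(1) = phi(a). *)
  exists (Psi L) => a Aa; rewrite -PsiE //.
  have [g lg ->] := slice a Aa; rewrite (phiE g lg).
  apply: (scaler_injr (oner_neq0 H)).
  transitivity (g (sw L (fun u v => Psi v *: u)) *: (1 : H)); last first.
    by rewrite coPsi // (klinZ lg).
  rewrite (sweedler_klin lPsi) (sweedler_klin lg).
  by apply: eq_sweedler => u v; rewrite (klinZ lPsi) (klinZ lg) mulrC.
Qed.
End Integral.
End Semisimple.
End Antipode.

(** * Assembly of the three statements *)

Theorem mainTheorem17 (k : fieldType) (H : algType k)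
  (Delta : H -> seq (H * H)) (eps : H -> k) (S : H -> H)
  (hH : is_hopf Delta eps S) :
  (forall L : H, integral_type Delta L ->
     (unimodular eps (A_of Delta L) ->
      (exists phi, cointegral1 Delta (A_of Delta L) phi /\
                   faithful (A_of Delta L) phi) ->
      S L = L /\ S2_stable S (A_of Delta L)) /\
     (L * L = L ->
      (exists phi, cointegral1 Delta (A_of Delta L) phi /\
                   faithful (A_of Delta L) phi) ->
      [/\ unimodular eps (A_of Delta L), S2_stable S (A_of Delta L),
          two_sided_glp Delta L & semisimple (A_of Delta L)])) /\
  (forall A : H -> Prop, left_coideal_subalg Delta A -> semisimple A ->
     S2_stable S A ->
     exists phi, [/\ cointegral1 Delta A phi, faithful A phi &
       forall psi, cointegral1 Delta A psi ->
         exists c : k, forall a, A a -> psi a = c * phi a]).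
Proof.
split=> [L hL|A /left_coideal_subalgP hA ssA S2A]; last first.
  have [L [AL eL intL intR]] := semisimple_integral hH hA ssA.
  exact: (semisimple_cointegral hH hA ssA S2A AL eL intL intR).
have hA := A_of_coideal_subalg hH L.
have AL : A_of Delta L L by exists L; exact: hL.2.
have intL := A_of_integral hH hL.
have extend phi : cointegral1 Delta (A_of Delta L) phi ->
    faithful (A_of Delta L) phi -> exists Phi, [/\ klin Phi,
    forall a, A_of Delta L a ->
      sweedler Delta a (fun u v => Phi v *: u) = Phi a *: 1 &
    faithful (A_of Delta L) Phi].
  move=> /(cointegral1_extend hA)[Phi [lPhi PhiE coPhi]] faith.
  exists Phi; split=> // a Aa Pa; apply: faith => // b Ab.
  by rewrite -PhiE ?Pa //; apply: (coideal_subalgM hA).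
split=> [unim|LL] [phi [cophi fphi]];
  have [Phi [lPhi coPhi fPhi]] := extend phi cophi fphi;
  have PL0 := cointegral_integral_neq0 hH hA lPhi coPhi fPhi AL hL.1 intL.
  have [_ intR] : R_eps eps (A_of Delta L) L by apply/unim; split.
  have SL := S_integral hH hA AL intL lPhi coPhi PL0 intR.
  by split=> //; apply: (S2_stable_A_of hH SL).
have intR := integral_right hH hA lPhi coPhi fPhi AL hL.1 intL LL.
have SL := S_integral hH hA AL intL lPhi coPhi PL0 intR.
have eL : eps L = 1.
  by apply: (scaler_injr hL.1); rewrite -intL // LL scale1r.
split.
- exact: (two_sided_integral_unimodular AL eL intL intR).
- exact: (S2_stable_A_of hH SL).
- exact: (integral_two_sided_glp hH hA AL eL intL SL intR).
- exact: (integral_semisimple hH hA AL eL intL SL).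
Qed.
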